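(* (1) $\mathrm{A}_\ell\text{-NP-sel}\subsetneq(\mathrm{NP}\cap\mathrm{coNP})/n+1$. (2) $\mathrm{A}_\ell\text{-NPMV-sel}\subsetneq \mathrm{NP}/n+1\,\cap\,\mathrm{coNP}/n+1$.
   Context: $\Sigma=\{0,1\}$. A 2-ary, possibly partial, possibly multivalued function $f$ assigns to each $(x,y)\in\Sigma^*\times\Sigma^*$ a set of values $\text{set-}f(x,y)\subseteq\Sigma^*$; $f(x,y)$ is undefined iff this set is empty; $f$ is total if it is never empty and single-valued if it always has at most one element. For sets $A$, $\text{set-}f(A,y)=\bigcup_{a\in A}\text{set-}f(a,y)$ and $\text{set-}f(y,A)=\bigcup_{a\in A}\text{set-}f(y,a)$. NPMV is the class of such functions $f$ for which there is a nondeterministic polynomial-time Turing machine $M$ such that for all $x,y$ the set of strings output on accepting paths of $M(x,y)$ equals $\text{set-}f(x,y)$; $\mathrm{NPSV}_t$ is the class of total, single-valued functions in NPMV. For a function class $\mathcal F$, an $\mathcal F$-selector function for $B\subseteq\Sigma^*$ is an $f\in\mathcal F$ such that for all $x,y$: $\text{set-}f(x,y)\subseteq\{x,y\}$, and if $\{x,y\}\cap B\neq\emptyset$ then $\text{set-}f(x,y)\neq\emptyset$ and $\text{set-}f(x,y)\subseteq B$. $f$ is associative at each length if for every $n$ and all $a,b,c\in\Sigma^n$, $\text{set-}f(a,\text{set-}f(b,c))=\text{set-}f(\text{set-}f(a,b),c)$. $\mathrm{A}_\ell$-NP-sel (respectively $\mathrm{A}_\ell$-NPMV-sel) is the class of sets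 having an $\mathrm{NPSV}_t$-selector (respectively NPMV-selector) function that is associative at each length. For a complexity class $\mathcal C$, a set $B$ is in $\mathcal C/n+1$ if there are $C\in\mathcal C$ and a function $h:1^*\to\Sigma^*$ (not necessarily computable) such that for all $x\in\Sigma^*$: $|h(1^{|x|})|=|x|+1$ and $x\in B\iff\langle x,h(1^{|x|})\rangle\in C$, where $\langle\cdot,\cdot\rangle$ is a standard polynomial-time computable and invertible pairing function. *)

(* Defs.v *)
From HB Require Import structures.
From mathcomp Require Import all_boot all_order all_algebra.
From mathcomp Require Import boolp classical_sets.

Set Implicit Arguments.
Unset Strict Implicit.
Unset Printing Implicit Defensive.

Local Open Scope classical_set_scope.

Definition word := seq bool.
Definition language := set word.

(* <x, y> = x_1 x_1 x_2 x_2 ... x_n x_n 0 1 y *)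
Definition pairing (x y : word) : word :=
  flatten [seq [:: b; b] | b <- x] ++ [:: false, true & y].

Lemma pairing_inj (x y x' y' : word) :
  pairing x y = pairing x' y' -> x = x' /\ y = y'.
Proof.
rewrite /pairing; elim: x x' => [|b x IHx] [|b' x'] /=.
- by case.
- by case: b'.
- by case: b.
- by move=> [-> _ /(IHx _)[-> ->]].
Qed.

(** Nondeterministic Turing machines: several two-way infinite read/write
    tapes, plus a write-only one-way output tape. *)

Inductive direction := Left | Stay | Right.

Definition ord_of_direction (d : direction) : 'I_3 :=
  match d with Left => inord 0 | Stay => inord 1 | Right => inord 2 end.
Definition direction_of_ord (i : 'I_3) : direction :=
  match val i with 0 => Left | 1 => Stay | _ => Right end.
Lemma ord_of_directionK : cancel ord_of_direction direction_of_ord.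
Proof. by case; rewrite /direction_of_ord /= inordK. Qed.
HB.instance Definition _ := Finite.copy direction (can_type ord_of_directionK).

(* None is the blank, Some (inl b) the input symbol b, and Some (inr g) an
   additional work symbol. *)
Definition symbol (G : Type) := option (bool + G).

(* An element (q, a, o) of [delta] enters state q, on each tape i writes
   (a i).1 and moves the head in direction (a i).2, and appends o, if any, to
   the output. *)
Record ntm := NTM {
  state : finType;
  tape : finType;
  extra : finType;
  start : state;
  input_tape : tape;
  accepting : {set state};
  delta : state -> {ffun tape -> symbol extra} ->
    {set state * {ffun tape -> symbol extra * direction} * option bool}
}.

Record config (M : ntm) := Config {
  cstate : state M;
  content : tape M -> int -> symbol (extra M);
  head_pos : tape M -> int
}.

Definition init_config (M : ntm) (x : word) : config M :=
  Config (start M)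
    (fun i j => match j with
                | Posz n => if i == input_tape M
                            then nth None [seq Some (inl b) | b <- x] n
                            else None
                | Negz _ => None
                end)
    (fun=> 0%R).

Definition shift (d : direction) (j : int) : int :=
  match d with
  | Left => (j - 1)%R
  | Stay => j
  | Right => (j + 1)%R
  end.

Definition scanned (M : ntm) (c : config M) : {ffun tape M -> symbol (extra M)} :=
  [ffun i => content c i (head_pos c i)].

Definition enabled (M : ntm) (c : config M) := delta (cstate c) (scanned c).

Definition apply_action (M : ntm) (c : config M) (q : state M)
    (a : {ffun tape M -> symbol (extra M) * direction}) : config M :=
  Config q
    (fun i j => if j == head_pos c i then (a i).1 else content c i j)
    (fun i => shift (a i).2 (head_pos c i)).

(* [run c n w c']: a computation path of n steps from c to c' that outputs w. *)
Inductive run (M : ntm) : config M -> nat -> word -> config M -> Prop :=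
| run_refl c : run c 0 [::] c
| run_step c q a o n w c' :
    (q, a, o) \in enabled c ->
    run (apply_action c q a) n w c' ->
    run c n.+1 (seq_of_opt o ++ w) c'.

Definition accepting_halt (M : ntm) (c : config M) : Prop :=
  enabled c = finset.set0 /\ cstate c \in accepting M.

Definition outputs (M : ntm) (x : word) : set word :=
  [set w | exists n c, run (init_config M x) n w c /\ accepting_halt c].

Definition accepts (M : ntm) (x : word) : Prop :=
  exists n w c, run (init_config M x) n w c /\ accepting_halt c.

(* Every computation path, accepting or not, is polynomially bounded. *)
Definition poly_time (M : ntm) : Prop :=
  exists p : {poly nat}, forall x n w c,
    run (init_config M x) n w c -> n <= (p.[size x])%R.

Definition NP : set language :=
  [set L | exists2 M, poly_time M & forall x, L x <-> accepts M x].

Definition coNP : set language := [set L | NP (~` L)].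

(* [f x y] is set-f(x, y). *)
Definition mvfun := word -> word -> set word.

Definition total (f : mvfun) : Prop := forall x y, f x y !=set0.

Definition single_valued (f : mvfun) : Prop :=
  forall x y u v, f x y u -> f x y v -> u = v.

Definition NPMV : set mvfun :=
  [set f | exists2 M, poly_time M &
     forall x y, outputs M (pairing x y) = f x y].

Definition NPSVt : set mvfun :=
  [set f | [/\ NPMV f, total f & single_valued f]].

Definition selector (f : mvfun) (B : language) : Prop :=
  forall x y, f x y `<=` [set x; y] /\
    ([set x; y] `&` B !=set0 -> f x y !=set0 /\ f x y `<=` B).

Definition set_ext_l (f : mvfun) (A : set word) (y : word) : set word :=
  \bigcup_(a in A) f a y.

Definition set_ext_r (f : mvfun) (y : word) (A : set word) : set word :=
  \bigcup_(a in A) f y a.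

Definition associative_at_each_length (f : mvfun) : Prop :=
  forall n (a b c : n.-tuple bool),
    set_ext_r f a (f b c) = set_ext_l f (f a b) c.

Definition Al_sel (F : set mvfun) : set language :=
  [set B | exists f, [/\ F f, selector f B & associative_at_each_length f]].

Definition Al_NP_sel := Al_sel NPSVt.
Definition Al_NPMV_sel := Al_sel NPMV.

(* C/n+1; only the values of h on 1^* matter. *)
Definition advice_n1 (C : set language) : set language :=
  [set B | exists2 L, C L & exists h : word -> word, forall x,
     let a := h (nseq (size x) true) in
     size a = (size x).+1 /\ (B x <-> L (pairing x a))].

(* Main.v *)
(** For words x, y of the same length n put x >= y if x is a value of f x y or of
    f y x.  Associativity makes >= transitive.  If B has a word of length n, then f
    is total on that length, >= is a total preorder, and B is an upper set, whence
    B is described by a minimal word b of B (x is in B iff x >= b) and its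
    complement by a maximal word c outside B (x is not in B iff c >= x).  Moreover
    one of the tests (x in f x b), (x in f b x) is correct for all x, so that one
    call to f decides membership when f is total and single-valued; the advice is
    b or c and one more bit, with unused codes for the degenerate lengths.

    Strictness holds because the machines are countable up to isomorphism: let B
    consist of the words of length k beginning with a bit beta k, and choose beta
    so that the k-th function in NPMV fails on the pair 00..0, 10..0. *)
Require Import Defs.
From mathcomp Require Import all_boot all_order all_algebra zify.
From mathcomp Require Import boolp classical_sets.

Set Implicit Arguments.
Unset Strict Implicit.
Unset Printing Implicit Defensive.

Import Order.TTheory GRing.Theory Num.Theory.

Local Open Scope set_scope.


(** * Acceptance, output and running time along computation paths *)

Section Paths.
Variable M : ntm.
Implicit Types c d : config M.

Definition take_action c (y : state M * {ffun tape M -> symbol (extra M) * direction} *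
    option bool) := apply_action c y.1.1 y.1.2.

Definition accepting_from c := exists n w d, run c n w d /\ accepting_halt d.

Definition bounded_by k c := forall n w d, run c n w d -> n <= k.

Lemma accepting_fromE c :
  accepting_from c <->
  accepting_halt c \/ exists2 y, y \in enabled c & accepting_from (take_action c y).
Proof.
split=> [[n [w [d [r hd]]]]|[hc|[[[q a] o] yc [n [w [d [r hd]]]]]]].
- case: r hd => {c n w d} [c|c q a o n w d qc r] hd; first by left.
  by right; exists (q, a, o) => //; exists n, w, d.
- by exists 0, [::], c; split=> //; constructor.
- by exists n.+1, (seq_of_opt o ++ w), d; split=> //; apply: run_step yc r.
Qed.

Definition outputs_from c w := exists n d, run c n w d /\ accepting_halt d.

Lemma outputs_fromE c w :
  outputs_from c w <->
  (accepting_halt c /\ w = [::]) \/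
  exists2 y, y \in enabled c &
    exists2 w', w = seq_of_opt y.2 ++ w' & outputs_from (take_action c y) w'.
Proof.
split=> [[n [d [r hd]]]|[[hc ->]|[[[q a] o] yc [w' -> [n [d [r hd]]]]]]].
- case: r hd => {c n w d} [c|c q a o n w d qc r] hd; first by left.
  by right; exists (q, a, o) => //; exists w => //; exists n, d.
- by exists 0, c; split=> //; constructor.
- by exists n.+1, d; split=> //; apply: run_step yc r.
Qed.

Lemma bounded_by_step k c :
  (forall y, y \in enabled c -> bounded_by k (take_action c y)) -> bounded_by k.+1 c.
Proof.
move=> H n w d r; case: r H => {c n w d} [//|c q a o n w d qc r] H.
by apply: (H _ qc) r.
Qed.

Lemma bounded_by_next k c y :
  bounded_by k.+1 c -> y \in enabled c -> bounded_by k (take_action c y).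
Proof.
by case: y => [[q a] o] H yc n w d r; have := H _ _ _ (run_step yc r).
Qed.

Lemma bounded_by0 c : bounded_by 0 c -> enabled c = finset.set0.
Proof.
move=> H; apply/finset.setP => -[[q a] o]; rewrite finset.inE; apply/negP => yc.
by have := H _ _ _ (run_step yc (run_refl _)).
Qed.

Lemma bounded_by_leq k l c : k <= l -> bounded_by k c -> bounded_by l c.
Proof. by move=> kl H n w d /H /leq_trans; apply. Qed.

(** Stretches without any choice: they preserve acceptance in both directions and add their length
    to the time bound, so the bookkeeping phases of a machine can be crossed by counting. Outputs
    are ignored, since only acceptance is tracked. *)
Inductive det_path : config M -> nat -> config M -> Prop :=
| det_refl c : det_path c 0 c
| det_step c y n c' : enabled c = [set y]%SET ->
    det_path (take_action c y) n c' -> det_path c n.+1 c'.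

Lemma det_path_trans c1 n1 c2 n2 c3 :
  det_path c1 n1 c2 -> det_path c2 n2 c3 -> det_path c1 (n1 + n2) c3.
Proof.
elim=> {c1 n1 c2} [//|c1 y n1 c2 e1 _ IH p2].
by rewrite addSn; apply: det_step e1 _; apply: IH.
Qed.

Lemma det_path_accepting c n c' :
  det_path c n c' -> (accepting_from c <-> accepting_from c').
Proof.
elim=> {c n c'} [//|c y n c' e _ <-]; rewrite accepting_fromE.
split=> [[[e' _]|[y']]|H].
- by have := finset.set11 y; rewrite -e e' finset.inE.
- by rewrite e => /finset.set1P ->.
- by right; exists y => //; rewrite e finset.set11.
Qed.

Lemma det_path_bounded c n c' k :
  det_path c n c' -> bounded_by k c' -> bounded_by (n + k) c.
Proof.
elim=> {c n c'} [//|c y n c' e _ IH H]; rewrite addSn.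
by apply: bounded_by_step => y'; rewrite e => /finset.set1P ->; apply: IH.
Qed.

End Paths.

(** * Tapes holding a single word *)

Section WordTape.
Variable G : eqType.

(** The offset [off] is the cell of the first letter; it varies because one word is written from
    right to left. *)
Definition word_tape (off : int) (w : word) : int -> symbol G := fun j =>
  match (j - off)%R with
  | Posz n => nth None [seq Some (inl b) | b <- w] n
  | Negz _ => None
  end.

Lemma word_tape_nth off w k :
  word_tape off w (off + Posz k)%R = nth None [seq Some (inl b) | b <- w] k.
Proof. by rewrite /word_tape addrC addKr. Qed.

Lemma word_tape_at off (p : word) b r j :
  j = (off + Posz (size p))%R -> word_tape off (p ++ b :: r) j = Some (inl b).
Proof.
by move=> ->; rewrite word_tape_nth map_cat nth_cat size_map ltnn subnn.
Qed.

Lemma word_tape_end off w j :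
  j = (off + Posz (size w))%R -> word_tape off w j = None.
Proof. by move=> ->; rewrite word_tape_nth nth_default // size_map. Qed.

Lemma word_tape_before off w j : (j < off)%R -> word_tape off w j = None.
Proof.
rewrite /word_tape -subr_lt0; by case: (j - off)%R.
Qed.

Lemma word_tape_nil off : word_tape off [::] = fun=> None.
Proof.
by apply/funext => j; rewrite /word_tape; case: (j - off)%R => // n; rewrite nth_nil.
Qed.

Lemma word_tape_rcons off w b h :
  h = (off + Posz (size w))%R ->
  (fun j => if j == h then Some (inl b) else word_tape off w j) =
  word_tape off (rcons w b).
Proof.
move=> ->; apply/funext => j; rewrite -cats1; case: eqVneq => [->|ne].
  by rewrite (@word_tape_at _ w).
rewrite /word_tape; case e: (j - off)%R => [n|//].
rewrite map_cat nth_cat size_map; case: ltnP => // h'.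
rewrite nth_default ?size_map //; case en: (n - size w) => [|m].
  by case/eqP: ne; lia.
by rewrite /= nth_nil.
Qed.

Lemma word_tape_cons off w b h :
  h = (off - 1)%R ->
  (fun j => if j == h then Some (inl b) else word_tape off w j) =
  word_tape h (b :: w).
Proof.
move=> ->; apply/funext => j; case: eqVneq => [->|ne].
  by rewrite -[b :: w]/([::] ++ b :: w) word_tape_at //= addr0.
rewrite /word_tape.
have -> : (j - (off - 1) = (j - off) + 1)%R by lia.
case e: (j - off)%R => [n|n].
  by have -> : (Posz n + 1)%R = Posz n.+1 by lia.
case: n e => [|n] e; first by case/eqP: ne; lia.
by have -> : (Negz n.+1 + 1)%R = Negz n by lia.
Qed.

(** Every action writes on every tape; this absorbs the write on a tape that is meant to stay
    unchanged. *)
Lemma word_tape_id off w h :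
  (fun j => if j == h then word_tape off w h else word_tape off w j) =
  word_tape off w.
Proof. by apply/funext => j; case: eqP => [->|]. Qed.

(** One scanned cell suffices to update the prefix flag; likewise, in the next lemma, a blank cell
    turns prefix into equality. *)
Lemma prefix_rcons_word_tape (w t : word) b :
  prefix (rcons w b) t =
  prefix w t && (word_tape 0 t (Posz (size w)) == Some (inl b)).
Proof.
rewrite -[Posz _]add0r word_tape_nth.
apply/prefixP/andP => [[r ->]|[/prefixP[r ->]]].
  rewrite cat_rcons prefix_prefix map_cat nth_cat size_map ltnn subnn /=.
  by rewrite eqxx.
rewrite map_cat nth_cat size_map ltnn subnn.
by case: r => [|b' r] //= /eqP[->]; exists r; rewrite cat_rcons.
Qed.

Lemma eq_word_tape_end (w t : word) :
  (w == t) = prefix w t && (word_tape 0 t (Posz (size w)) == None).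
Proof.
rewrite -[Posz _]add0r word_tape_nth.
apply/eqP/andP => [->|[/prefixP[r ->]]].
  by rewrite prefix_refl nth_default ?size_map.
rewrite map_cat nth_cat size_map ltnn subnn.
by case: r => [|b' r] //=; rewrite cats0.
Qed.

End WordTape.

Arguments word_tape {G} off w _.
(** * Nondeterministic machines making one call to a transducer *)

Section Oracle.
Variables (M : ntm) (Q : finType) (q0 : Q) (step : Q -> bool -> Q).
Variable emit : Q -> bool -> option (bool * bool).
Variable dec : Q -> {set option (bool * bool * bool)}.

(* [emit q b = Some (t, b')] appends b' to the word of index t. *)
Definition emitted (e : option (bool * bool)) (u : bool -> word) : bool -> word :=
  fun t => match e with
           | Some (t', b) => if t' == t then rcons (u t) b else u t
           | None => u t
           end.

Fixpoint transduce (q : Q) (u : bool -> word) (z : word) : Q * (bool -> word) :=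
  if z is b :: z' then transduce (step q b) (emitted (emit q b) u) z'
  else (q, u).

Definition call_pairing (u : bool -> word) (swap : bool) :=
  pairing (u swap) (u (~~ swap)).

(* In the final state q of the transduction, one element of [dec q] is guessed:
   [None] accepts at once, and [Some (swap, target, pol)] runs M on the pairing
   of the two emitted words (exchanged if [swap]) and accepts if the truth value
   of (output = word of index [target]) is [pol]. *)
Definition one_call_language : language := [set z |
  let: (q, u) := transduce q0 (fun=> [::]) z in
  None \in dec q \/
  exists swap target pol, Some (swap, target, pol) \in dec q /\
    exists2 w, outputs M (call_pairing u swap) w & (w == u target) = pol]%classic.

Let st : finType :=
  ((Q + (bool * bool * bool) * (bool * bool)) +
   option ((bool * bool * bool) * bool * state M))%type.
Let tp : finType := (option bool + tape M)%type.
Let sym := symbol (extra M).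

(* The tapes are the input, the two emitted words, and the tapes of M.  While
   assembling, the pairing is written right to left on the input tape of M, so
   that all heads end at the left ends of their words without rewinding; the
   phases (false, false), (false, true), (true, false), (true, true) copy the
   second word and the first separator bit, write the other separator bit, and
   write the two copies of a bit of the first word. *)
Notation parsing q := (inl (inl q)).
Notation assembling cl ph := (inl (inr (cl, ph))).
Notation simulating cl eq q := (inr (Some (cl, eq, q))).
Notation accepted := (inr None).

Definition oc_action (s : {ffun tp -> sym}) (dI : direction)
    (ft : bool -> sym * direction) (fm : tape M -> sym * direction) :
    {ffun tp -> sym * direction} :=
  [ffun i => match i with
             | inl None => (s (inl None), dI)
             | inl (Some t) => ft t
             | inr j => fm j
             end].

Definition oc_emit (e : option (bool * bool)) (s : {ffun tp -> sym}) (t : bool) :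
    sym * direction :=
  match e with
  | Some (t', b) => if t' == t then (Some (inl b), Right)
                    else (s (inl (Some t)), Stay)
  | None => (s (inl (Some t)), Stay)
  end.

Definition oc_move (d : bool -> direction) (s : {ffun tp -> sym}) (t : bool) :
    sym * direction := (s (inl (Some t)), d t).

Definition oc_write (a : sym * direction) (s : {ffun tp -> sym}) (j : tape M) :
    sym * direction :=
  if j == input_tape M then a else (s (inr j), Stay).

Definition oc_stay (s : {ffun tp -> sym}) (j : tape M) : sym * direction :=
  (s (inr j), Stay).

Definition only_left (t0 t : bool) : direction := if t == t0 then Left else Stay.

Definition oc_enter (o : option (bool * bool * bool)) : st :=
  if o is Some cl then assembling cl (false, false) else accepted.

Definition compare (eq : bool) (a : sym) (o : option bool) : bool :=
  if o is Some b then eq && (a == Some (inl b)) else eq.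

(** The output of M is never stored: each letter is compared at once with the scanned letter of the
    target tape, whose head advances exactly when a letter is output. *)
Definition oc_lift cl (eq : bool) (s : {ffun tp -> sym})
    (y : state M * {ffun tape M -> sym * direction} * option bool) :
    st * {ffun tp -> sym * direction} * option bool :=
  let: (q, a, o) := y in
  (simulating cl (compare eq (s (inl (Some cl.1.2))) o) q,
   oc_action s Stay
     (oc_move (fun t => if (t == cl.1.2) && (o != None) then Right else Stay) s)
     (fun j => a j),
   None).

Definition oc_delta (q : st) (s : {ffun tp -> sym}) :
    {set st * {ffun tp -> sym * direction} * option bool} :=
  match q with
  | parsing q =>
    match s (inl None) with
    | Some (inl b) =>
      [set (parsing (step q b),
            oc_action s Right (oc_emit (emit q b) s) (oc_stay s), None)]%SET
    (* At the end of the input the heads of the two word tapes stand one cell past their words and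
       step back onto the last letters. *)
    | _ => [set (oc_enter o,
                 oc_action s Stay (oc_move (fun=> Left) s) (oc_stay s), None)
           | o in dec q]%SET
    end
  | assembling cl (false, false) =>
    match s (inl (Some (~~ cl.1.1))) with
    | Some (inl b) =>
      [set (assembling cl (false, false),
            oc_action s Stay (oc_move (only_left (~~ cl.1.1)) s)
              (oc_write (Some (inl b), Left) s), None)]%SET
    | _ =>
      [set (assembling cl (false, true),
            oc_action s Stay (oc_move (fun=> Stay) s)
              (oc_write (Some (inl true), Left) s), None)]%SET
    end
  | assembling cl (false, true) =>
    [set (assembling cl (true, false),
          oc_action s Stay (oc_move (fun=> Stay) s)
            (oc_write (Some (inl false), Left) s), None)]%SET
  | assembling cl (true, false) =>
    match s (inl (Some cl.1.1)) with
    | Some (inl b) =>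
      [set (assembling cl (true, true),
            oc_action s Stay (oc_move (fun=> Stay) s)
              (oc_write (Some (inl b), Left) s), None)]%SET
    (* The blank left of the first word ends the pairing; one step right puts these heads on the
       first letters of their words. *)
    | _ =>
      [set (simulating cl true (start M),
            oc_action s Stay (oc_move (fun=> Right) s)
              (oc_write (s (inr (input_tape M)), Right) s), None)]%SET
    end
  | assembling cl (true, true) =>
    match s (inl (Some cl.1.1)) with
    | Some (inl b) =>
      [set (assembling cl (true, false),
            oc_action s Stay (oc_move (only_left cl.1.1) s)
              (oc_write (Some (inl b), Left) s), None)]%SET
    | _ => finset.set0
    end
  | simulating cl eq q =>
    let D := delta q [ffun j => s (inr j)] in
    if D == finset.set0 then
      (* Only an accepting halt of M has an output; the blank on the target tape tells that the
         target is exhausted too. *)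
      if (q \in accepting M) &&
         ((eq && (s (inl (Some cl.1.2)) == None)) == cl.2)
      then [set (accepted,
                 oc_action s Stay (oc_move (fun=> Stay) s) (oc_stay s), None)]%SET
      else finset.set0
    else [set oc_lift cl eq s y | y in D]%SET
  | accepted => finset.set0
  end.

Definition one_call : ntm :=
  @NTM st tp (extra M) (parsing q0) (inl None) [set accepted]%SET oc_delta.

Definition oc_config (q : st) (z : word) (hI : int) (u : bool -> word)
    (h : bool -> int) (mt : tape M -> int -> sym) (mh : tape M -> int) :
    config one_call :=
  @Config one_call q
    (fun i => match i with
              | inl None => word_tape 0 z
              | inl (Some t) => word_tape 0 (u t)
              | inr j => mt j
              end)
    (fun i => match i with
              | inl None => hI
              | inl (Some t) => h t
              | inr j => mh j
              end).

(** * Correctness and running time of the one-call machine *)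

Lemma take_action_oc_config q z hI u h mt mh (q' : st) dI ft fm
    (o : option bool) :
  let c := oc_config q z hI u h mt mh in
  take_action c (q', oc_action (scanned c) dI ft fm, o) =
  @Config one_call q'
    (fun i => match i with
              | inl None => word_tape 0 z
              | inl (Some t) => fun j => if j == h t then (ft t).1
                                         else word_tape 0 (u t) j
              | inr i => fun j => if j == mh i then (fm i).1 else mt i j
              end)
    (fun i => match i with
              | inl None => shift dI hI
              | inl (Some t) => shift (ft t).2 (h t)
              | inr i => shift (fm i).2 (mh i)
              end).
Proof.
rewrite /take_action /apply_action /=; congr Config; apply/funext => -[[t|]|i] /=;
  rewrite ffunE //; apply/funext => j.
by rewrite ffunE /=; case: eqP => // ->.
Qed.

Lemma init_oc_config z :
  init_config one_call z =
  oc_config (parsing q0) z 0 (fun=> [::]) (fun=> 0%R) (fun _ _ => None) (fun=> 0%R).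
Proof.
congr Config; first by apply/funext => -[[t|]|i] //=; apply/funext => j;
  rewrite /word_tape ?subr0; case: (j) => // n; rewrite nth_nil.
by apply/funext => -[[t|]|i].
Qed.

(** Invariant: each word head stands just after the letters emitted so far, so emitting is one write
    and one move. *)
Lemma parsing_path z p r q u :
  z = p ++ r ->
  det_path
    (oc_config (parsing q) z (size p) u (fun t => size (u t)) (fun _ _ => None)
       (fun=> 0%R))
    (size r)
    (let: (q', u') := transduce q u r in
     oc_config (parsing q') z (size z) u' (fun t => size (u' t)) (fun _ _ => None)
       (fun=> 0%R)).
Proof.
elim: r p q u => [|b r IH] p q u ez /=.
  by rewrite ez cats0; constructor.
set c := oc_config _ _ _ _ _ _ _.
have scI : scanned c (inl None) = Some (inl b).
  by rewrite ffunE /= ez word_tape_at // add0r.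
set a := oc_action (scanned c) Right (oc_emit (emit q b) (scanned c))
  (oc_stay (scanned c)).
apply: (@det_step one_call c (parsing (step q b), a, None)).
  by rewrite /enabled /= scI.
rewrite take_action_oc_config.
have := IH (rcons p b) (step q b) (emitted (emit q b) u).
rewrite cat_rcons => /(_ ez); congr det_path.
congr Config; apply/funext => -[[t|]|i] //=.
- rewrite /emitted /oc_emit; case: (emit q b) => [[t' b']|].
    case: eqP => [_|_] /=; first by rewrite word_tape_rcons // add0r.
    by rewrite ffunE /= word_tape_id.
  by rewrite ffunE /= word_tape_id.
- by apply/funext => j; rewrite ffunE /= if_same.
- rewrite /emitted /oc_emit; case: (emit q b) => [[t' b']|//].
  by case: eqP => [_|_] //=; rewrite size_rcons -addn1 PoszD.
- by rewrite size_rcons -addn1 PoszD.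
Qed.

Definition blank_but (tm : int -> sym) (i : tape M) : int -> sym :=
  if i == input_tape M then tm else fun=> None.

Definition head_but (h : int) (i : tape M) : int :=
  if i == input_tape M then h else 0%R.

Definition asm_config q z hI u h off w hw : config one_call :=
  oc_config q z hI u h (blank_but (word_tape off w)) (head_but hw).

Lemma asm_write z hI u h off w q q' d b :
  let c := asm_config q z hI u h off w (off - 1)%R in
  take_action c (q', oc_action (scanned c) Stay (oc_move d (scanned c))
    (oc_write (Some (inl b), Left) (scanned c)), None) =
  asm_config q' z hI u (fun t => shift (d t) (h t)) (off - 1) (b :: w) (off - 2)%R.
Proof.
rewrite /asm_config take_action_oc_config /=.
congr Config; apply/funext => -[[t|]|i] //=.
- by rewrite ffunE /= word_tape_id.
- rewrite /blank_but /head_but /oc_write ffunE; case: eqP => [_|ne] /=.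
    by rewrite word_tape_cons.
  by rewrite /blank_but; case: eqP ne => // _ _; apply/funext => j; rewrite if_same.
- rewrite /head_but /oc_write; case: eqP => [_|//] /=; lia.
Qed.

Definition move_to (h : bool -> int) (t0 : bool) (k : int) (t : bool) : int :=
  if t == t0 then k else h t.

Lemma scanned_word q z hI u h mt mh t :
  scanned (oc_config q z hI u h mt mh) (inl (Some t)) = word_tape 0 (u t) (h t).
Proof. by rewrite ffunE. Qed.

Lemma word_tape_last (u p r : word) b (k : int) :
  u = rcons p b ++ r -> k = (Posz (size p))%R ->
  word_tape 0 u k = Some (inl b) :> sym.
Proof. by move=> -> ->; rewrite cat_rcons word_tape_at // add0r. Qed.

(** Induction from the right end, the direction of copying; [r] is the part already passed, and the
    head stops on the blank cell [-1]. *)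
Lemma copy_path cl z hI u h p r off w :
  u (~~ cl.1.1) = p ++ r ->
  det_path
    (asm_config (assembling cl (false, false)) z hI u
      (move_to h (~~ cl.1.1) (Posz (size p) - 1)%R) off w (off - 1)%R)
    (size p)
    (asm_config (assembling cl (false, false)) z hI u
      (move_to h (~~ cl.1.1) (- 1)%R) (off - Posz (size p))%R (p ++ w)
      (off - Posz (size p) - 1)%R).
Proof.
elim/last_ind: p r off w => [|p b IH] r off w eu /=.
  by rewrite sub0r subr0; constructor.
rewrite size_rcons.
set c := asm_config _ _ _ _ _ _ _ _.
apply: (@det_step one_call c (assembling cl (false, false),
  oc_action (scanned c) Stay (oc_move (only_left (~~ cl.1.1)) (scanned c))
              (oc_write (Some (inl b), Left) (scanned c)), None)).
  rewrite /enabled /= /c scanned_word (word_tape_last eu) //.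
  by rewrite /move_to eqxx; lia.
rewrite asm_write.
have := IH (b :: r) (off - 1)%R (b :: w).
rewrite -cat_rcons => /(_ eu).
congr det_path.
- congr asm_config; last by lia.
  by apply/funext => t; rewrite /move_to /only_left; case: eqP => //= _; lia.
- by rewrite cat_rcons; congr asm_config; lia.
Qed.

Lemma double_path cl z hI u h p r off w :
  u cl.1.1 = p ++ r ->
  det_path
    (asm_config (assembling cl (true, false)) z hI u
      (move_to h cl.1.1 (Posz (size p) - 1)%R) off w (off - 1)%R)
    (size p).*2
    (asm_config (assembling cl (true, false)) z hI u
      (move_to h cl.1.1 (- 1)%R) (off - Posz (size p).*2)%R
      (flatten [seq [:: b; b] | b <- p] ++ w)
      (off - Posz (size p).*2 - 1)%R).
Proof.
elim/last_ind: p r off w => [|p b IH] r off w eu /=.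
  by rewrite sub0r subr0; constructor.
rewrite size_rcons doubleS.
set c := asm_config _ _ _ _ _ _ _ _.
apply: (@det_step one_call c (assembling cl (true, true),
  oc_action (scanned c) Stay (oc_move (fun=> Stay) (scanned c))
              (oc_write (Some (inl b), Left) (scanned c)), None)).
  rewrite /enabled /= /c scanned_word (word_tape_last eu) //.
  by rewrite /move_to eqxx; lia.
rewrite asm_write (_ : off - 2 = off - 1 - 1)%R; last by lia.
set c' := asm_config _ _ _ _ _ _ _ _.
apply: (@det_step one_call c' (assembling cl (true, false),
  oc_action (scanned c') Stay (oc_move (only_left cl.1.1) (scanned c'))
              (oc_write (Some (inl b), Left) (scanned c')), None)).
  rewrite /enabled /= /c' scanned_word (word_tape_last eu) //.
  by rewrite /move_to eqxx /=; lia.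
rewrite asm_write.
have := IH (b :: r) (off - 1 - 1)%R (b :: b :: w).
rewrite -cat_rcons => /(_ eu).
congr det_path.
- congr asm_config; last by lia.
  by apply/funext => t; rewrite /move_to /only_left; case: eqP => //= _; lia.
- rewrite map_rcons flatten_rcons -catA; congr asm_config; lia.
Qed.

Lemma assembling_path cl z hI u :
  exists off,
  det_path
    (asm_config (assembling cl (false, false)) z hI u
      (fun t => Posz (size (u t)) - 1)%R 1 [::] 0)
    (size (u (~~ cl.1.1)) + (size (u cl.1.1)).*2 + 3)
    (asm_config (simulating cl true (start M)) z hI u (fun=> 0%R)
       off (call_pairing u cl.1.1) off).
Proof.
set n2 := size (u (~~ cl.1.1)); set n1 := size (u cl.1.1).
set h := fun t => (Posz (size (u t)) - 1)%R.
(* The empty word sits at offset [1], so that the first write hits cell [0]; the offset then drops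
   by one per letter of the second word, the separator and the doubled first word. *)
pose off : int := (1 - Posz n2 - 1 - 1 - Posz n1.*2)%R; exists off.
have := @copy_path cl z hI u h (u (~~ cl.1.1)) [::] 1%R [::].
rewrite !cats0 => /(_ erefl) p1.
rewrite [X in det_path X](_ : _ = asm_config (assembling cl (false, false)) z hI u
      (move_to h (~~ cl.1.1) (Posz n2 - 1)%R) 1%R [::] (1 - 1)%R); last first.
  congr asm_config; apply/funext => t; rewrite /move_to /h.
  by case: eqP => [->|].
rewrite -!addnA; apply: det_path_trans p1 _; rewrite -/n2.
set c := asm_config _ _ _ _ _ _ _ _.
rewrite !addnS addn0.
apply: (@det_step one_call c (assembling cl (false, true),
  oc_action (scanned c) Stay (oc_move (fun=> Stay) (scanned c))
              (oc_write (Some (inl true), Left) (scanned c)), None)).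
  by rewrite /enabled /= /c scanned_word /move_to eqxx word_tape_before.
rewrite asm_write (_ : 1 - Posz n2 - 2 = 1 - Posz n2 - 1 - 1)%R; last by lia.
set c' := asm_config _ _ _ _ _ _ _ _.
apply: (@det_step one_call c' (assembling cl (true, false),
  oc_action (scanned c') Stay (oc_move (fun=> Stay) (scanned c'))
              (oc_write (Some (inl false), Left) (scanned c')), None)).
  by rewrite /enabled.
rewrite asm_write.
have := @double_path cl z hI u (move_to h (~~ cl.1.1) (-1)%R) (u cl.1.1) [::]
  (1 - Posz n2 - 1 - 1)%R [:: false, true & u (~~ cl.1.1)].
rewrite cats0 => /(_ erefl) p2.
rewrite -/n1 in p2.
rewrite [X in det_path X](_ : _ = asm_config (assembling cl (true, false)) z hI u
  (move_to (move_to h (~~ cl.1.1) (-1)) cl.1.1 (Posz n1 - 1)) 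
  (1 - Posz n2 - 1 - 1) [:: false, true  & u (~~ cl.1.1)]
  (1 - Posz n2 - 1 - 1 - 1))%R; last first.
  congr asm_config; last by lia.
  apply/funext => t; rewrite /= /move_to /h; case: eqP => [->|]; last by case: eqP => [->|].
  by case: (cl.1.1).
rewrite -addn1; apply: det_path_trans p2 _.
rewrite -/off.
set c2 := asm_config _ _ _ _ _ _ _ _.
apply: (@det_step one_call c2 (simulating cl true (start M),
  oc_action (scanned c2) Stay (oc_move (fun=> Right) (scanned c2))
              (oc_write (scanned c2 (inr (input_tape M)), Right) (scanned c2)), None)).
  by rewrite /enabled /= /c2 scanned_word /move_to eqxx word_tape_before.
rewrite take_action_oc_config.
rewrite [X in det_path X _ _](_ : _ = (asm_config (simulating cl true (start M)) z hI u (fun=> 0%R)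
       off (call_pairing u cl.1.1) off)); first exact: det_refl.
congr Config; apply/funext => -[[t|]|i] //=.
- by rewrite ffunE /= word_tape_id.
- rewrite /oc_write ffunE /=; case: eqP => [->|ne] /=.
    by rewrite /blank_but /head_but eqxx word_tape_id.
  by rewrite ffunE /=; apply/funext => j; case: eqP => // ->.
- by rewrite /move_to; case: eqP => //; case: eqP => //; case: (cl.1.1) t => [] [].
- rewrite /head_but /oc_write; case: eqP => //= _; lia.
Qed.

(* The input tape of M is shifted by [off]; [eq] records whether the output so
   far is a prefix of the target word, whose tape serves for the comparison. *)
Definition sim_config cl eq z hI u h off (c : config M) : config one_call :=
  oc_config (simulating cl eq (cstate c)) z hI u h
    (fun i j => content c i (j - head_but off i)%R)
    (fun i => head_pos c i + head_but off i)%R.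

Lemma sim_config_init cl z hI u h off w :
  asm_config (simulating cl true (start M)) z hI u h off w off =
  sim_config cl true z hI u h off (init_config M w).
Proof.
congr Config; apply/funext => -[t|i] //=; rewrite ?add0r //.
rewrite /blank_but /head_but; apply/funext => j; rewrite /word_tape.
by case: eqP => // _; case: (_ - _)%R.
Qed.

Lemma scanned_sim cl eq z hI u h off c :
  [ffun i => scanned (sim_config cl eq z hI u h off c) (inr i)] = scanned c.
Proof. by apply/ffunP => i; rewrite !ffunE /= addrK. Qed.

Lemma take_action_sim cl eq z hI u h off c y :
  let s := scanned (sim_config cl eq z hI u h off c) in
  take_action (sim_config cl eq z hI u h off c) (oc_lift cl eq s y) =
  sim_config cl (compare eq (word_tape 0 (u cl.1.2) (h cl.1.2)) y.2) z hI u
    (fun t => shift (if (t == cl.1.2) && (y.2 != None) then Right else Stay) (h t))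
    off (take_action c y).
Proof.
case: y => [[q a] o] /=; rewrite take_action_oc_config /= scanned_word.
congr Config; apply/funext => -[[t|]|i] //=.
- by rewrite ffunE /= word_tape_id.
- by apply/funext => j; rewrite subr_eq.
- by case: (a i).2 => //=; lia.
Qed.

Lemma enabled_accepted (c : config one_call) :
  cstate c = accepted -> enabled c = finset.set0.
Proof. by rewrite /enabled => ->. Qed.

Lemma accepting_from_accepted (c : config one_call) :
  cstate c = accepted -> accepting_from c.
Proof.
move=> hc; apply/accepting_fromE; left; split; first exact: enabled_accepted.
by rewrite hc /= finset.set11.
Qed.

Lemma bounded_by_accepted k (c : config one_call) :
  cstate c = accepted -> bounded_by k c.
Proof.
move=> hc n w d r; case: r hc => // {c n w d} c q a o n w d qc _ /enabled_accepted.
by move=> e; rewrite e finset.inE in qc.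
Qed.

Definition oc_accept (c : config one_call) :=
  (accepted, oc_action (scanned c) Stay (oc_move (fun=> Stay) (scanned c))
     (oc_stay (scanned c)), None) :
  state one_call * {ffun tape one_call -> symbol (extra one_call) * direction} *
  option bool.

(** The position of the target head is prescribed only while the output [w] is a prefix of the
    target: after a mismatch the flag stays false for good. *)
Lemma enabled_sim cl z hI u h off c w c' :
  (prefix w (u cl.1.2) -> h cl.1.2 = Posz (size w)) ->
  c' = sim_config cl (prefix w (u cl.1.2)) z hI u h off c ->
  enabled c' =
    if enabled c == finset.set0 then
      if (cstate c \in accepting M) && ((w == u cl.1.2) == cl.2)
      then [set oc_accept c']%SET else finset.set0
    else [set oc_lift cl (prefix w (u cl.1.2)) (scanned c') y | y in enabled c]%SET.
Proof.
move=> hw ->; rewrite {1}/enabled /= scanned_sim -/(enabled c) scanned_word.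
rewrite (eq_word_tape_end (extra M)).
by case: (boolP (prefix _ _)) => //= /hw ->.
Qed.

Lemma sim_halted cl z hI u h off k c w :
  enabled c = finset.set0 ->
  (prefix w (u cl.1.2) -> h cl.1.2 = Posz (size w)) ->
  (accepting_from (sim_config cl (prefix w (u cl.1.2)) z hI u h off c) <->
   exists2 w', outputs_from c w' & (w ++ w' == u cl.1.2) = cl.2) /\
  bounded_by k.+1 (sim_config cl (prefix w (u cl.1.2)) z hI u h off c).
Proof.
move=> e0 hw; set c' := sim_config _ _ _ _ _ _ _ _.
have := enabled_sim hw (erefl c'); rewrite e0 eqxx => enE; split; last first.
  apply: bounded_by_step => y; rewrite enE; case: ifP => _; rewrite ?finset.inE //.
  by move=> /eqP ->; apply: bounded_by_accepted.
rewrite accepting_fromE; split=> [[[_]|[y]]|[w']].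
- by rewrite /= finset.inE.
- rewrite enE; case: ifP; rewrite ?finset.inE // => /andP[ha /eqP hp] _ _.
  by exists [::]; rewrite ?cats0 //; apply/outputs_fromE; left.
- move=> /outputs_fromE[[[_ ha] ->]|[y]]; last by rewrite e0 finset.inE.
  rewrite cats0 => hp; right; exists (oc_accept c').
    by rewrite enE ha hp eqxx finset.set11.
  exact: accepting_from_accepted.
Qed.

Lemma compare_prefix (w v : word) o h :
  (prefix w v -> h = Posz (size w)) ->
  compare (prefix w v) (word_tape 0 v h) o = prefix (w ++ seq_of_opt o) v.
Proof.
move=> hw; case: o => [b|] /=; last by rewrite cats0.
rewrite cats1 (prefix_rcons_word_tape (extra M)).
by case: (boolP (prefix w v)) => //= /hw ->.
Qed.

(** Induction on the time bound of M, generalized over the output [w] so far. Each step of M costs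
    one step; the extra one enters the accepting state. *)
Lemma sim_correct cl z hI u off k c w h :
  bounded_by k c ->
  (prefix w (u cl.1.2) -> h cl.1.2 = Posz (size w)) ->
  (accepting_from (sim_config cl (prefix w (u cl.1.2)) z hI u h off c) <->
   exists2 w', outputs_from c w' & (w ++ w' == u cl.1.2) = cl.2) /\
  bounded_by k.+1 (sim_config cl (prefix w (u cl.1.2)) z hI u h off c).
Proof.
elim: k c w h => [|k IH] c w h bc hw.
  by apply: sim_halted => //; apply: bounded_by0.
have [e0|ne0] := eqVneq (enabled c) finset.set0; first exact: sim_halted.
set c' := sim_config _ _ _ _ _ _ _ _.
have := enabled_sim hw (erefl c'); rewrite (negPf ne0) => enE.
have {}IH y : y \in enabled c ->
    (accepting_from (take_action c'
        (oc_lift cl (prefix w (u cl.1.2)) (scanned c') y)) <->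
     exists2 w', outputs_from (take_action c y) w' &
       ((w ++ seq_of_opt y.2) ++ w' == u cl.1.2) = cl.2) /\
    bounded_by k.+1 (take_action c'
        (oc_lift cl (prefix w (u cl.1.2)) (scanned c') y)).
  move=> yc; rewrite take_action_sim compare_prefix //.
  apply: IH; first exact: bounded_by_next yc.
  case: y.2 => [b|] /=; last by rewrite cats0 andbF.
  rewrite eqxx cats1 (prefix_rcons_word_tape (extra M)) => /andP[/hw -> _] /=.
  by rewrite size_rcons; lia.
split; last first.
  apply: bounded_by_step => y'; rewrite enE => /finset.imsetP[y yc ->].
  by have [_] := IH _ yc.
rewrite accepting_fromE; split=> [[[_]|[y']]|[w']].
- by rewrite /= finset.inE.
- rewrite enE => /finset.imsetP[y yc ->] /(proj1 (IH _ yc))[w' ow' hp].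
  exists (seq_of_opt y.2 ++ w'); last by rewrite catA.
  by apply/outputs_fromE; right; exists y => //; exists w'.
- move=> /outputs_fromE[[[e0] _]|[y yc [w2 ->]]].
    by rewrite e0 eqxx in ne0.
  rewrite catA => ow hp; right.
  exists (oc_lift cl (prefix w (u cl.1.2)) (scanned c') y).
    by rewrite enE; apply: finset.imset_f.
  by apply/(proj1 (IH _ yc)); exists w2.
Qed.

Lemma size_transduce q u z t :
  size ((transduce q u z).2 t) <= size (u t) + size z.
Proof.
elim: z q u => [|b z IH] q u /=; first by rewrite addn0.
apply: leq_trans (IH _ _) _; rewrite addnS -addSn leq_add2r /emitted.
by case: (emit q b) => [[t' b']|//]; case: ifP => _ //; rewrite size_rcons.
Qed.

Lemma take_action_enter q z hI u (o : option (bool * bool * bool)) :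
  let c := oc_config (parsing q) z hI u (fun t => size (u t)) (fun _ _ => None)
    (fun=> 0%R) in
  take_action c (oc_enter o, oc_action (scanned c) Stay
    (oc_move (fun=> Left) (scanned c)) (oc_stay (scanned c)), None) =
  asm_config (oc_enter o) z hI u (fun t => Posz (size (u t)) - 1)%R 1 [::] 0.
Proof.
move=> c; rewrite take_action_oc_config.
congr Config; apply/funext => -[[t|]|i] //=.
- by rewrite ffunE /= word_tape_id.
- rewrite ffunE /= /blank_but word_tape_nil if_same.
  by apply/funext => j; rewrite if_same.
- by rewrite /head_but if_same.
Qed.

(** In the bound, [n + n.*2 + 3] pays for assembling the pairing, [k.+1] for the simulation and the
    outer successor for the guess in [dec q]. *)
Lemma decision_correct q z u k n :
  (forall swap, bounded_by k (init_config M (call_pairing u swap))) ->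
  (forall t, size (u t) <= n) ->
  let c := oc_config (parsing q) z (size z) u (fun t => size (u t))
    (fun _ _ => None) (fun=> 0%R) in
  (accepting_from c <->
   None \in dec q \/ exists swap target pol, Some (swap, target, pol) \in dec q /\
    exists2 w, outputs M (call_pairing u swap) w & (w == u target) = pol) /\
  bounded_by (n + n.*2 + 3 + k.+1).+1 c.
Proof.
move=> bM un c.
have enE : enabled c = [set (oc_enter o, oc_action (scanned c) Stay
    (oc_move (fun=> Left) (scanned c)) (oc_stay (scanned c)), None) | o in dec q]%SET.
  by rewrite /enabled /= /c ffunE /= word_tape_end // add0r.
have nextE o : take_action c (oc_enter o, oc_action (scanned c) Stay
    (oc_move (fun=> Left) (scanned c)) (oc_stay (scanned c)), None) =
    asm_config (oc_enter o) z (size z) u (fun t => Posz (size (u t)) - 1)%R 1 [::] 0.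
  exact: take_action_enter.
have callE cl (c' := asm_config (assembling cl (false, false)) z (size z) u
    (fun t => Posz (size (u t)) - 1)%R 1 [::] 0) :
  (accepting_from c' <->
   exists2 w, outputs M (call_pairing u cl.1.1) w & (w == u cl.1.2) = cl.2) /\
  bounded_by (n + n.*2 + 3 + k.+1) c'.
  have [off path] := assembling_path cl z (size z) u.
  rewrite sim_config_init in path.
  have := @sim_correct cl z (size z) u off k
    (init_config M (call_pairing u cl.1.1)) [::] (fun=> 0%R) (bM _).
  rewrite prefix0s => -[//|acc bnd].
  split; first by rewrite (det_path_accepting path).
  apply: bounded_by_leq (det_path_bounded path bnd).
  by rewrite leq_add2r leq_add2r leq_add // leq_double.
split; last first.
  apply: bounded_by_step => y; rewrite enE => /finset.imsetP[o oq ->].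
  rewrite nextE; case: o oq => [cl|] _; first by case: (callE cl).
  exact: bounded_by_accepted.
rewrite accepting_fromE; split=> [[[_]|[y]]|].
- by rewrite /= finset.inE.
- rewrite enE => /finset.imsetP[o oq ->]; rewrite nextE.
  case: o oq => [[[swap target] pol]|] oq /=; last by left.
  by case: (callE (swap, target, pol)) => [[H _] _] /H; right; exists swap, target, pol.
- case=> [oq|[swap [target [pol [oq H]]]]]; right.
    exists (oc_enter None, oc_action (scanned c) Stay
      (oc_move (fun=> Left) (scanned c)) (oc_stay (scanned c)), None).
      by rewrite enE; apply: (finset.imset_f (fun o => (oc_enter o, _, _)) oq).
    exact: accepting_from_accepted.
  exists (oc_enter (Some (swap, target, pol)), oc_action (scanned c) Stay
    (oc_move (fun=> Left) (scanned c)) (oc_stay (scanned c)), None).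
    by rewrite enE; apply: (finset.imset_f (fun o => (oc_enter o, _, _)) oq).
  by rewrite nextE; apply/(callE (swap, target, pol)).1.
Qed.

Lemma size_pairing x y : size (pairing x y) = (size x).*2 + (size y).+2.
Proof.
rewrite /pairing size_cat; congr addn.
by elim: x => //= b x ->; rewrite doubleS.
Qed.

(** The emitted words are no longer than the input, so M is called on a word of length at most
    [n.*2 + n.+2]; monotonicity of [b] makes that length count. *)
Lemma one_call_correct (b : nat -> nat) z :
  (forall m n, m <= n -> b m <= b n) ->
  (forall x, bounded_by (b (size x)) (init_config M x)) ->
  let n := size z in
  (accepts one_call z <-> one_call_language z) /\
  bounded_by (n + (n + n.*2 + 3 + (b (n.*2 + n.+2)).+1).+1) (init_config one_call z).
Proof.
move=> b_mono bM n.
rewrite -[accepts _ _]/(accepting_from (init_config one_call z)) init_oc_config.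
have := @parsing_path z [::] z q0 (fun=> [::]) erefl.
have := @size_transduce q0 (fun=> [::]) z.
rewrite /one_call_language /=; case: (transduce _ _ _) => q u /= su path.
have [|//|acc bnd] := @decision_correct q z u (b (n.*2 + n.+2)) n.
  move=> swap; apply: bounded_by_leq (bM _); apply: b_mono.
  by rewrite size_pairing leq_add ?leq_double ?ltnS.
split; last exact: det_path_bounded path bnd.
by rewrite -acc -(det_path_accepting path).
Qed.

End Oracle.

Lemma horner_nat_mono (p : {poly nat}) m n : m <= n -> p.[m]%R <= p.[n]%R.
Proof.
move=> mn; elim/poly_ind: p => [|p c IH]; first by rewrite !horner0.
by rewrite !hornerMXaddC; apply: leq_add => //; apply: leq_mul.
Qed.

Lemma one_call_language_NP (M : ntm) (Q : finType) (q0 : Q) step emit dec :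
  poly_time M -> NP (one_call_language M q0 step emit dec).
Proof.
move=> [p pM].
have bM x : bounded_by p.[size x]%R (init_config M x) by move=> n w c; apply: pM.
have main := one_call_correct q0 step emit dec _ (horner_nat_mono p) bM.
exists (one_call M q0 step emit dec); last by move=> z; rewrite (main z).1.
(* The call costs at most [p] at 3n + 2, and all other steps add up to 4n + 5. *)
exists (4%:P * 'X + 5%:P + (p \Po (3%:P * 'X + 2%:P)))%R => z n w c.
move=> /(main z).2 /leq_trans; apply.
rewrite !hornerD horner_comp !hornerD !hornerCM !hornerX !hornerC.
set s := size z.
have -> : (3%:R * s + 2%:R)%R = s.*2 + s.+2.
  rewrite -[LHS]/(3 * s + 2); lia.
have arith k : s + (s + s.*2 + 3 + k.+1).+1 <= 4 * s + 5 + k by lia.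
exact: arith.
Qed.

(** * Countably many machines *)

(** With states, tapes and extra symbols renamed to ordinals, a machine is a finite object, and
    countability is inferred from the type. *)
Definition ntm_table (s t e : nat) : countType :=
  ('I_s * 'I_t * {set 'I_s} *
   {ffun 'I_s * {ffun 'I_t -> option (bool + 'I_e)} ->
      {set 'I_s * {ffun 'I_t -> option (bool + 'I_e) * direction} * option bool}})%type.

Definition ntm_code : countType := {n : nat * nat * nat & ntm_table n.1.1 n.1.2 n.2}.

Definition ntm_of_code (k : ntm_code) : ntm :=
  let: existT n (q0, i0, acc, tab) := k in
  @NTM 'I_n.1.1 'I_n.1.2 'I_n.2 q0 i0 acc (fun q s => tab (q, s)).

Section Encoding.
Variable M : ntm.

Definition encode_symbol (a : symbol (extra M)) : symbol 'I_#|extra M| :=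
  match a with
  | None => None
  | Some (inl b) => Some (inl b)
  | Some (inr g) => Some (inr (enum_rank g))
  end.

Definition decode_symbol (a : symbol 'I_#|extra M|) : symbol (extra M) :=
  match a with
  | None => None
  | Some (inl b) => Some (inl b)
  | Some (inr g) => Some (inr (enum_val g))
  end.

Lemma encode_symbolK : cancel encode_symbol decode_symbol.
Proof. by case=> [[b|g]|] //=; rewrite enum_rankK. Qed.

Definition encode_step
    (y : state M * {ffun tape M -> symbol (extra M) * direction} * option bool) :
    'I_#|state M| *
    {ffun 'I_#|tape M| -> option (bool + 'I_#|extra M|) * direction} * option bool :=
  (enum_rank y.1.1,
   [ffun i => (encode_symbol (y.1.2 (enum_val i)).1, (y.1.2 (enum_val i)).2)],
   y.2).

Definition code_of_ntm : ntm_code :=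
  existT (fun n : nat * nat * nat => ntm_table n.1.1 n.1.2 n.2)
    (#|state M|, #|tape M|, #|extra M|)
    (enum_rank (start M), enum_rank (input_tape M),
     [set enum_rank q | q in accepting M]%SET,
     [ffun qs : 'I_#|state M| * {ffun 'I_#|tape M| -> option (bool + 'I_#|extra M|)} =>
      [set encode_step y
        | y in delta (enum_val qs.1) [ffun i => decode_symbol (qs.2 (enum_rank i))]]%SET]).

Let N := ntm_of_code code_of_ntm.

Definition encode_config (c : config M) : config N :=
  @Config N (enum_rank (cstate c))
    (fun i j => encode_symbol (content c (enum_val i) j))
    (fun i => head_pos c (enum_val i)).

Lemma enabled_encode c :
  enabled (encode_config c) = [set encode_step y | y in enabled c]%SET.
Proof.
rewrite /enabled /= ffunE /= enum_rankK; congr imset; congr (mem (delta _ _)).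
by apply/ffunP => i; rewrite !ffunE /= enum_rankK encode_symbolK.
Qed.

Lemma take_action_encode c y :
  take_action (encode_config c) (encode_step y) = encode_config (take_action c y).
Proof.
congr Config; apply/funext => i; rewrite ffunE //=.
by apply/funext => j; case: eqP.
Qed.

Lemma init_encode x : init_config N x = encode_config (init_config M x).
Proof.
congr Config; apply/funext => i; apply/funext => -[n|n] //=.
rewrite (can2_eq (@enum_valK _) (@enum_rankK _)); case: eqP => // _.
by elim: x n => [|b x IH] [|n] //=.
Qed.

Lemma accepting_halt_encode c : accepting_halt (encode_config c) <-> accepting_halt c.
Proof.
rewrite /accepting_halt enabled_encode /=.
rewrite (mem_imset _ _ (@enum_rank_inj _)); split=> -[e ->]; split=> //.
  by apply/eqP; rewrite -(imset_eq0 encode_step) e.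
by rewrite e imset0.
Qed.

Lemma run_encode c n w d : run c n w d -> run (encode_config c) n w (encode_config d).
Proof.
elim=> {c n w d} [c|c q a o n w d qc _]; first by constructor.
rewrite -[apply_action c q a]/(take_action c (q, a, o)) -take_action_encode.
by apply: run_step; rewrite enabled_encode; apply: (finset.imset_f encode_step qc).
Qed.

(** The enabled actions of the copy are exactly the encoded ones, so a run from an encoded
    configuration never leaves the encoded ones. *)
Lemma run_of_encode c' n w d' : run c' n w d' ->
  forall c, c' = encode_config c -> exists2 d, d' = encode_config d & run c n w d.
Proof.
elim=> {c' n w d'} [c' c ->|c' q a o n w d' qc _ IH c ec].
  by exists c => //; constructor.
move: qc; rewrite ec enabled_encode => /finset.imsetP[[[q1 a1] o1] yc ey].
have [|d -> r] := IH (take_action c (q1, a1, o1)).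
  by rewrite -take_action_encode -ey -ec.
exists d => //; case: ey => _ _ ->.
exact: run_step yc r.
Qed.

Lemma outputs_encode x : outputs N x = outputs M x.
Proof.
apply/predeqP => w; rewrite /outputs /= init_encode.
split=> -[n [d [r hd]]].
  have [d1 ed r1] := run_of_encode r erefl.
  by exists n, d1; split=> //; apply/accepting_halt_encode; rewrite -ed.
exists n, (encode_config d); split; first exact: run_encode.
exact/accepting_halt_encode.
Qed.

End Encoding.

(** Codes carry no time bound, so functions outside NPMV may be listed as well; for diagonalizing it
    suffices that none of NPMV is missed. *)
Lemma NPMV_enumerable :
  exists e : nat -> mvfun, forall f, NPMV f -> exists n, e n = f.
Proof.
exists (fun n => if @unpickle ntm_code n is Some k
                 then fun x y => outputs (ntm_of_code k) (pairing x y)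
                 else fun _ _ => set0).
move=> f [M _ fM]; exists (pickle (code_of_ntm M)); rewrite pickleK.
by apply/funext => x; apply/funext => y; rewrite outputs_encode fM.
Qed.

(** * Associative selectors on words of one length *)

Lemma total_preorder_min (T : eqType) (R : T -> T -> Prop) (s : seq T) :
  {in s &, forall x y, R x y \/ R y x} ->
  {in s & &, forall x y z, R x y -> R y z -> R x z} ->
  s <> [::] -> exists2 m, m \in s & {in s, forall x, R x m}.
Proof.
elim: s => [//|a s IH] tot tr _.
have raa : R a a by have [] := tot a a (mem_head _ _) (mem_head _ _).
have [->|/eqP s0] := eqVneq s [::].
  by exists a; [exact: mem_head | move=> x; rewrite inE => /eqP ->].
have sub : {subset s <= a :: s} by move=> x; rewrite inE orbC => ->.
have [||//|m ms hm] := IH.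
- by move=> x y /sub xs /sub ys; apply: tot.
- by move=> x y z /sub xs /sub ys /sub zs; apply: tr.
have [ram|rma] := tot a m (mem_head _ _) (sub _ ms).
  by exists m; [exact: sub | move=> x; rewrite inE => /orP[/eqP ->|/hm]].
exists a; first exact: mem_head.
move=> x; rewrite inE => /orP[/eqP -> //|xs].
exact: (tr x m a (sub _ xs) (sub _ ms) (mem_head _ _) (hm _ xs) rma).
Qed.

(** Serves twice: with [above] on B, and with the reversed relation on the complement, where it
    yields a maximal word. *)
Lemma min_word (n : nat) (P : word -> Prop) (R : word -> word -> Prop) :
  (exists2 x, size x = n & P x) ->
  (forall x y, size x = n -> size y = n -> P x -> P y -> R x y \/ R y x) ->
  (forall x y z, size x = n -> size y = n -> size z = n -> P x -> P y -> P z ->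
     R x y -> R y z -> R x z) ->
  exists m, [/\ size m = n, P m & forall x, size x = n -> P x -> R x m].
Proof.
move=> [x0 sx0 Px0] tot tr.
pose s := [seq x <- [seq tval t | t : n.-tuple bool] | `[< P x >]].
have sP x : x \in s <-> size x = n /\ P x.
  rewrite mem_filter; split=> [/andP[/asboolP Px /mapP[t _ e]]|[sx Px]].
    by split=> //; rewrite e size_tuple.
  apply/andP; split; first exact/asboolP.
  by apply/mapP; exists (Tuple (introT eqP sx)); rewrite ?mem_enum.
have [||e|m /sP[sm Pm] hm] := @total_preorder_min _ R s.
- by move=> x y /sP[sx Px] /sP[sy Py]; apply: tot.
- by move=> x y z /sP[sx Px] /sP[sy Py] /sP[sz Pz]; apply: tr.
- by have := proj2 (sP x0) (conj sx0 Px0); rewrite e.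
by exists m; split=> // x sx Px; apply: hm; apply/sP.
Qed.

Section Selector.
Variables (f : mvfun) (B : language) (n : nat).
Hypothesis selfB : selector f B.
Hypothesis assoc_f : associative_at_each_length f.

Definition above x y := f x y x \/ f y x x.

Lemma assoc_word a b c v : size a = n -> size b = n -> size c = n ->
  (exists2 w, f b c w & f a w v) <-> (exists2 w, f a b w & f w c v).
Proof.
move=> /eqP sa /eqP sb /eqP sc.
by have /predeqP/(_ v) := assoc_f (Tuple sa) (Tuple sb) (Tuple sc).
Qed.

Lemma sel_cases x y v : f x y v -> v = x \/ v = y.
Proof. by have [+ _] := selfB x y => /[apply]. Qed.

Lemma sel_in x y v : B x \/ B y -> f x y v -> B v.
Proof.
move=> Bxy; have [_ H] := selfB x y; apply: (proj2 (H _)).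
by case: Bxy => ?; [exists x | exists y]; split=> //; [left | right].
Qed.

Lemma sel_ex x y : B x \/ B y -> exists v, f x y v.
Proof.
move=> Bxy; have [_ H] := selfB x y; apply: (proj1 (H _)).
by case: Bxy => ?; [exists x | exists y]; split=> //; [left | right].
Qed.

(* Associating b, x, y with b in B forces f to be defined on all words of the
   length of b, including those outside B. *)
Lemma sel_total x y : (exists2 b, size b = n & B b) -> size x = n -> size y = n ->
  exists v, f x y v.
Proof.
move=> [b sb Bb] sx sy.
have [w fw] := @sel_ex _ y (or_introl Bb).
have [w' fw'] := @sel_ex _ x (or_introl Bb).
have Bw' := sel_in (or_introl Bb) fw'.
have [v fv] := @sel_ex _ y (or_introl Bw').
have [_ /(_ (ex_intro2 _ _ w' fw' fv))[u fu _]] := assoc_word v sb sx sy.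
by exists u.
Qed.

Lemma above_total x y : (exists v, f x y v) -> above x y \/ above y x.
Proof.
move=> [v fv]; have [e|e] := sel_cases fv; rewrite e in fv.
  by left; left.
by right; right.
Qed.

(* If x were in neither f x z nor f z x, then x would be a value of only one of
   the two bracketings of a suitable product of x, y and z. *)
Lemma above_trans x y z : size x = n -> size y = n -> size z = n -> x <> z ->
  above x y -> above y z -> above x z.
Proof.
move=> sx sy sz xz.
have [-> //|/eqP xy] := eqVneq x y.
have [-> //|/eqP yz] := eqVneq y z.
move=> xy_yx yz_zy; case: (pselect (above x z)) => // nxz; exfalso.
have nxz1 : ~ f x z x by move=> ?; apply: nxz; left.
have nxz2 : ~ f z x x by move=> ?; apply: nxz; right.
have nyzx u v : f u v x -> (u = y /\ v = z) \/ (u = z /\ v = y) -> False.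
  by move=> fx [[eu ev]|[eu ev]]; case: (sel_cases fx); rewrite ?eu ?ev => e;
    subst; congruence.
(* The four cases use the products xyz, xzy, yzx and zyx. Evaluating y and z first gives y and then
   x; the other bracketing puts x into [f x z] or [f z x], or into a product of y and z. *)
case: xy_yx => hx; case: yz_zy => hy.
- have [/(_ (ex_intro2 _ _ y hy hx))[w fw fx] _] := assoc_word x sx sy sz.
  by case: (sel_cases fw) fx => -> fx //; apply: nyzx fx _; left.
- have [/(_ (ex_intro2 _ _ y hy hx))[w fw fx] _] := assoc_word x sx sz sy.
  case: (sel_cases fw) => ew; subst w; first exact: nxz1.
  by apply: nyzx fx _; right.
- have [_ /(_ (ex_intro2 _ _ y hy hx))[w fw fx]] := assoc_word x sy sz sx.
  case: (sel_cases fw) => ew; subst w; last exact: nxz2.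
  by apply: nyzx fx _; left.
- have [_ /(_ (ex_intro2 _ _ y hy hx))[w fw fx]] := assoc_word x sz sy sx.
  by case: (sel_cases fw) fx => -> fx //; apply: nyzx fx _; right.
Qed.

(** Let y refute the first alternative and x the second. If x is a value of [f y x], it is one of
    (by)x, and b(yx) then puts x into [f b x] or [f b y], both absurd. Otherwise y is a value of
    [f y x] and of y(xb), and (yx)b puts y into [f y b] or x into [f y x]. *)
Lemma above_side b : size b = n -> B b ->
  (forall x, size x = n -> B x -> above x b) ->
  (forall x, size x = n -> B x -> f x b x) \/
  (forall x, size x = n -> B x -> f b x x).
Proof.
move=> sb Bb hb; apply: contrapT => /not_orP[].
move=> /existsNP[y /not_implyP[sy /not_implyP[By ny]]].
move=> /existsNP[x /not_implyP[sx /not_implyP[Bx nx]]].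
have fxb : f x b x by have [] := hb x sx Bx.
have fby : f b y y by have [] := hb y sy By.
have fyb : f y b b.
  have [v fv] := @sel_ex _ b (or_introl By).
  by case: (sel_cases fv) => e; subst v; [case: (ny fv) |].
have [fyx|nfyx] := pselect (f y x x).
  have [_ /(_ (ex_intro2 _ _ y fby fyx))[w fw fx]] := assoc_word x sb sy sx.
  case: (sel_cases fw) => ew; subst w; last exact: nx.
  by case: (sel_cases fx) => e; subst x.
have fyxy : f y x y.
  have [v fv] := @sel_ex _ x (or_introl By).
  by case: (sel_cases fv) => e; subst v; [| case: (nfyx fv)].
have [/(_ (ex_intro2 _ _ x fxb fyxy))[w fw fy] _] := assoc_word y sy sx sb.
by case: (sel_cases fw) => ew; subst w; [exact: nx | exact: nfyx].
Qed.

(* The advice is t :: b with b minimal in B at this length; t tells on which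
   side b multiplies ([above_side]).
   The code false :: 0^n is reserved for B having no word of length n. *)
Definition np_test (x a : word) : Prop :=
  if a is t :: b then
    ~~ (~~ t && all negb b) /\ (if t then f b x x else f x b x)
  else False.

(* The reserved code is avoided when 0^n is itself minimal: if only its left
   products work, another minimal word exists. *)
Lemma np_advice : exists2 a, size a = n.+1 &
  forall x, size x = n -> (B x <-> np_test x a).
Proof.
(* Soundness uses only that b is in B: every value of a product with a member of B is in B. *)
have test_in x a : size x = n -> B (behead a) -> np_test x a -> B x.
  case: a => [|[] b] //= sx Bb [_]; apply: sel_in; [left | right]; exact: Bb.
have [neB|/forallNP eB] := pselect (exists x, size x = n /\ B x); last first.
  exists (false :: nseq n false); first by rewrite /= size_nseq.
  move=> x sx; rewrite /= all_nseq orbT; split=> [Bx|[]//].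
  by case: (eB x).
have [b [sb Bb hb]] : exists m,
    [/\ size m = n, B m & forall x, size x = n -> B x -> above x m].
  have neB2 : exists2 x, size x = n & B x by case: neB => x [sx Bx]; exists x.
  apply: min_word => // [x y sx sy Bx By|x y z sx sy sz Bx By Bz xy yz].
    by apply: above_total; apply: sel_total.
  have [exz|/eqP xz] := eqVneq x z.
    by rewrite exz; case: (@sel_ex z z (or_introl Bz)) => v fv;
      left; case: (sel_cases fv) => e; rewrite e in fv.
  exact: above_trans xy yz.
have codeP t c : size c = n -> B c -> ~~ (~~ t && all negb c) ->
    (forall x, size x = n -> B x -> if t then f c x x else f x c x) ->
    exists2 a, size a = n.+1 & forall x, size x = n -> (B x <-> np_test x a).
  move=> sc Bc nz hc; exists (t :: c); first by rewrite /= sc.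
  move=> x sx; split=> [Bx|]; last exact: (test_in _ (t :: c)).
  by split=> //; exact: hc.
have [hl|hr] := above_side sb Bb hb; last exact: (codeP true b).
have [zb|nzb] := boolP (all negb b); last exact: (codeP false b).
have [hr|nhr] := pselect (forall x, size x = n -> B x -> f b x x).
  exact: (codeP true b).
(* Since c is not a value of [f b c], b is; so b is above c, and c is minimal by transitivity. As c
   differs from b, which is all zeros, it avoids the reserved code with either flag. *)
have [c [sc Bc fbcc]] : exists c, [/\ size c = n, B c & ~ f b c c].
  apply: contrapT => H; apply: nhr => x sx Bx.
  by apply: contrapT => nf; apply: H; exists x.
have bc : b <> c by move=> e; apply: fbcc; rewrite -e; exact: hl.
have zc : ~~ all negb c.
  apply/negP => zc; apply: bc; apply: (@eq_from_nth _ true); rewrite ?sb ?sc // => i hi.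
  have := all_nthP true zb i; have := all_nthP true zc i; rewrite sb sc hi.
  by move=> /(_ isT) /negPf -> /(_ isT) /negPf ->.
have fbcb : f b c b.
  have [v fv] := @sel_ex b c (or_introl Bb).
  by case: (sel_cases fv) => e; subst v.
have hc x : size x = n -> B x -> above x c.
  move=> sx Bx; have [exc|/eqP xc] := eqVneq x c.
    by rewrite exc; case: (@sel_ex c c (or_introl Bc)) => v fv;
      left; case: (sel_cases fv) => e; rewrite e in fv.
  by apply: above_trans (hb x sx Bx) _ => //; left.
by have [] := above_side sc Bc hc; [apply: (codeP false c) | apply: (codeP true c)].
Qed.

(* true :: c with c nonempty carries a maximal word c outside B.  When B has no
   word of length n the advice is 0^(n+1); when it has all of them it is
   false :: 1^n, or [:: true] if n = 0, and both of these reject. *)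
Definition conp_test (x a : word) : Prop :=
  match a with
  | true :: c => c != [::] /\ (f x c c \/ f c x c)
  | false :: c => all negb c
  | [::] => False
  end.

(** If c outside B is a value of a product with x, then x is outside B; conversely a maximal such c
    is above x. Comparing words outside B rests on [sel_total]. *)
Lemma conp_advice : exists2 a, size a = n.+1 &
  forall x, size x = n -> (~ B x <-> conp_test x a).
Proof.
have [neB|/forallNP eB] := pselect (exists x, size x = n /\ B x); last first.
  exists (false :: nseq n false); first by rewrite /= size_nseq.
  move=> x sx; rewrite /= all_nseq orbT; split=> // _ Bx.
  by case: (eB x).
have [neC|/forallNP eC] := pselect (exists x, size x = n /\ ~ B x); last first.
  exists ((n == 0) :: nseq n true); first by rewrite /= size_nseq.
  move=> x sx; split=> [nBx|]; first by case: (eC x).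
  by case: (n) => [|k] /= => [[]|].
have neB2 : exists2 x, size x = n & B x by case: neB => x [sx Bx]; exists x.
have [c [sc nBc hc]] : exists m,
    [/\ size m = n, ~ B m & forall x, size x = n -> ~ B x -> above m x].
  apply: (@min_word n (fun x => ~ B x) (fun x y => above y x)).
  - by case: neC => x [sx nBx]; exists x.
  - by move=> x y sx sy _ _; apply: above_total; apply: sel_total.
  - move=> x y z sx sy sz _ _ _ xy yz; have [exz|/eqP xz] := eqVneq x z.
      by rewrite exz; case: (@sel_total z z neB2 sz sz) => v fv;
        left; case: (sel_cases fv) => e; rewrite e in fv.
    by apply: above_trans yz xy => // e; apply: xz.
exists (true :: c); first by rewrite /= sc.
move=> x sx; split=> [nBx|[_ H] Bx].
  split; last by case: (hc x sx nBx); [right | left].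
  (* An empty c would be the only word of its length, yet some word of that length is in B. *)
  apply/eqP => c0; case: nBc; case: neB => y [sy By].
  by move: sc sy; rewrite c0 => /= <- /size0nil ey; rewrite -ey.
by apply: nBc; case: H; apply: sel_in; [left | right].
Qed.

End Selector.

(** * The advice tests as one-call languages *)

(* Parses [pairing x (t :: c)], sending x to word [false] and c to word [true];
   [reading_second t ne z] records whether c is nonempty and whether it consists
   of zeros only. *)
Definition parser_state : finType := (option bool + (bool + bool * bool * bool))%type.

Local Notation reading_first := (inl None).
Local Notation reading_first_half b := (inl (Some b)).
Local Notation malformed := (inr (inl false)).
Local Notation reading_flag := (inr (inl true)).
Local Notation reading_second t ne z := (inr (inr (t, ne, z))).

Definition parser_step (q : parser_state) (b : bool) : parser_state :=
  match q with
  | reading_first => reading_first_half b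
  | reading_first_half b' =>
      if b' == b then reading_first else if b then reading_flag else malformed
  | inr (inl r) => if r then reading_second b false true else malformed
  | reading_second t _ z => reading_second t true (z && ~~ b)
  end.

Definition parser_emit (q : parser_state) (b : bool) : option (bool * bool) :=
  match q with
  | reading_first_half b' => if b' == b then Some (false, b) else None
  | reading_second _ _ _ => Some (true, b)
  | _ => None
  end.

(** The flag t is the order of the arguments in the call, and the target is x. With [pol] false
    every verdict is reversed, which is meant to yield the complement. *)
Definition np_decision (pol : bool) (q : parser_state) :
    {set option (bool * bool * bool)} :=
  match q with
  | reading_second t _ z =>
      if ~~ t && z then if pol then finset.set0 else [set None]%SET
      else [set Some (t, false, pol)]%SET
  | _ => if pol then finset.set0 else [set None]%SET
  end.

Definition conp_decision (q : parser_state) : {set option (bool * bool * bool)} :=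
  match q with
  | reading_second true ne _ =>
      if ne then [set Some (swap, true, true) | swap in [set: bool]%SET]%SET
      else finset.set0
  | reading_second false _ z => if z then [set None]%SET else finset.set0
  | _ => finset.set0
  end.

Lemma parser_first u x r :
  transduce parser_step parser_emit reading_first u
    (flatten [seq [:: b; b] | b <- x] ++ r) =
  transduce parser_step parser_emit reading_first
    (fun i => if i then u i else u i ++ x) r.
Proof.
elim: x u => [|b x IH] u /=.
  by congr transduce; apply/funext => i; rewrite cats0 if_same.
rewrite eqxx IH; congr transduce; apply/funext => -[] //=.
by rewrite cat_rcons.
Qed.

Lemma parser_second t ne z u c :
  transduce parser_step parser_emit (reading_second t ne z) u c =
  (reading_second t (ne || (c != [::])) (z && all negb c),
   fun i => if i then u i ++ c else u i).
Proof.
elim: c ne z u => [|b c IH] ne z u /=.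
  by rewrite orbF andbT; congr pair; apply/funext => i; rewrite cats0 if_same.
rewrite IH andbA orbT; congr pair; apply/funext => -[] //=.
by rewrite cat_rcons.
Qed.

Lemma parser_pairing x t c :
  transduce parser_step parser_emit reading_first (fun=> [::]) (pairing x (t :: c)) =
  (reading_second t (c != [::]) (all negb c), fun i => if i then c else x).
Proof.
rewrite /pairing parser_first /= parser_second /=.
by congr pair; apply/funext => -[].
Qed.

Section Oracle_languages.
Variables (M : ntm) (f : mvfun).
Hypothesis outM : forall x y, outputs M (pairing x y) = f x y.

Definition np_language pol : language :=
  one_call_language M reading_first parser_step parser_emit (np_decision pol).

Definition conp_language : language :=
  one_call_language M reading_first parser_step parser_emit conp_decision.

Lemma np_language_test x t c :
  np_language true (pairing x (t :: c)) <-> np_test f x (t :: c).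
Proof.
rewrite /np_language /one_call_language /= parser_pairing /np_decision.
case: ifP => _.
  rewrite finset.inE; split=> [[//|[? [? [? [+ _]]]]]|[]//].
  by rewrite finset.inE.
rewrite finset.inE; split=> [[//|[sw [tg [p [+ [w]]]]]]|[_ ft]].
  rewrite finset.inE => /eqP[-> -> ->]; rewrite outM => fw /eqP ew; split=> //.
  by rewrite ew in fw; case: (t) fw.
right; exists t, false, true; rewrite finset.set11; split=> //.
by exists x; rewrite ?eqxx // outM; case: (t) ft.
Qed.

Lemma conp_language_test x t c :
  conp_language (pairing x (t :: c)) <-> conp_test f x (t :: c).
Proof.
rewrite /conp_language /one_call_language /= parser_pairing /conp_decision.
case: t; last first.
  case: ifP => _; rewrite finset.inE; first by split=> // _; left.
  by split=> // -[//|[? [? [? [+ _]]]]]; rewrite finset.inE.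
case: ifP => _; last first.
  by rewrite finset.inE; split=> [[//|[? [? [? [+ _]]]]]|[]//]; rewrite finset.inE.
split=> [[/finset.imsetP[]//|[sw [tg [p [/finset.imsetP[s _ [-> -> ->]]]]]]]|[_ H]].
  move=> [w]; rewrite outM => fw /eqP ew; split=> //; rewrite ew in fw.
  by case: s fw; [right | left].
right; case: H => H; [exists false | exists true]; exists true, true.
  split; first exact: finset.imset_f.
  by exists c; rewrite ?eqxx // outM.
split; first exact: finset.imset_f.
by exists c; rewrite ?eqxx // outM.
Qed.

(** The complement must be right on malformed words too, hence the case analysis on the final parser
    state. When a call is made there is exactly one output, equal to the target or not. *)
Lemma np_language_compl : Defs.total f -> single_valued f ->
  forall z, (~ np_language true z) <-> np_language false z.
Proof.
move=> tf sf z; rewrite /np_language /one_call_language /=.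
case: (transduce _ _ _ _ _) => q u.
have constP : ~ (None \in finset.set0 \/ exists swap target pol,
     Some (swap, target, pol) \in finset.set0 /\
    exists2 w, outputs M (call_pairing u swap) w & (w == u target) = pol) <->
    None \in [set None : option (bool * bool * bool)]%SET \/ exists swap target pol,
     Some (swap, target, pol) \in [set None : option (bool * bool * bool)]%SET /\
    exists2 w, outputs M (call_pairing u swap) w & (w == u target) = pol.
  split=> _; first by left; rewrite finset.set11.
  by case=> [|[? [? [? []]]]]; rewrite finset.inE.
rewrite /np_decision; case: q => [o|[r|[[t ne] z']]]; try exact: constP.
case: ifP => _; first exact: constP.
have callP pol : (None \in [set Some (t, false, pol)]%SET \/ exists swap target pol',
     Some (swap, target, pol') \in [set Some (t, false, pol)]%SET /\
    exists2 w, outputs M (call_pairing u swap) w & (w == u target) = pol') <->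
    exists2 w, f (u t) (u (~~ t)) w & (w == u false) = pol.
  rewrite finset.inE; split=> [[//|[sw [tg [p [+ [w]]]]]]|[w fw ew]].
    by rewrite finset.inE => /eqP[-> -> ->]; rewrite outM => fw ew; exists w.
  right; exists t, false, pol; rewrite finset.set11; split=> //.
  by exists w; rewrite ?outM.
rewrite !callP; split=> [H|[w fw ew] [w' fw' ew']].
  have [w fw] := tf (u t) (u (~~ t)).
  by exists w => //; apply/negP => ew; apply: H; exists w.
by rewrite (sf _ _ _ _ fw fw') ew' in ew.
Qed.

End Oracle_languages.

(** * Strictness *)

(** A stub for the call, which [ends_decision] never makes. *)
Definition idle_ntm : ntm :=
  @NTM unit unit void tt tt finset.set0 (fun _ _ => finset.set0).

Lemma idle_poly_time : poly_time idle_ntm.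
Proof.
exists 0%R => x n w c r; case: r => // {}c q a o {}n {}w c'.
by rewrite finset.inE.
Qed.

(** Keeps the first and last letters read. On [pairing x a] these are the first of x and the last of
    a, so for constant advice comparing them decides [head_language]. *)
Definition ends_step (q : option (bool * bool)) (b : bool) : option (bool * bool) :=
  Some (if q is Some (b0, _) then b0 else b, b).

Definition ends_decision (pol : bool) (q : option (bool * bool)) :
    {set option (bool * bool * bool)} :=
  if (if q is Some (b0, b1) then b0 == b1 else false) == pol then [set None]%SET
  else finset.set0.

Definition ends_language (pol : bool) : language :=
  one_call_language idle_ntm None ends_step (fun _ _ => None) (ends_decision pol).

Lemma ends_transduce emit b0 b u z :
  (transduce ends_step emit (Some (b0, b)) u z).1 = Some (b0, last b z).
Proof. by elim: z b u => //= b' z IH b u; rewrite /ends_step IH. Qed.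

Lemma ends_languageP pol b z : ends_language pol (b :: z) <-> (b == last b z) = pol.
Proof.
rewrite /ends_language /one_call_language /=.
have := ends_transduce (fun _ _ => None) b b (emitted None (fun=> [::])) z.
case: (transduce _ _ _ _ _) => q u /= ->; rewrite /ends_decision.
case: eqP => [<-|ne].
  by split=> // _; left; rewrite finset.set11.
by rewrite finset.inE; split=> // -[//|[? [? [? []]]]]; rewrite finset.inE.
Qed.

Lemma ends_language_compl : (~` ends_language true)%classic = ends_language false.
Proof.
apply/predeqP => -[|b z]; last first.
  by rewrite /setC /= !ends_languageP; case: eqP.
rewrite /setC /ends_language /one_call_language /= /ends_decision /= !finset.inE.
by split=> _; [left | move=> [//|[? [? [? []]]]]; rewrite finset.inE].
Qed.

Definition head_language (beta : nat -> bool) : language :=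
  [set x | head false x = beta (size x)]%classic.

Lemma head_language_advice beta :
  advice_n1 (NP `&` coNP)%classic (head_language beta).
Proof.
exists (ends_language true).
  split; first exact/one_call_language_NP/idle_poly_time.
  rewrite /coNP /= ends_language_compl.
  exact/one_call_language_NP/idle_poly_time.
exists (fun w => nseq (size w).+1 (beta (size w))) => x /=.
rewrite size_nseq size_nseq; split=> //.
(* For empty x the first letter is the [false] of the separator, in agreement with [head false
   [::]]. *)
have -> : pairing x (beta (size x) :: nseq (size x) (beta (size x))) =
    head false x :: behead (pairing x (beta (size x) :: nseq (size x) (beta (size x)))).
  by case: x.
rewrite ends_languageP /head_language /=.
rewrite (_ : last _ _ = beta (size x)); last first.
  rewrite /pairing.
  have lastn b n : last b (nseq n b) = b by elim: n.
  by case: x => [|b x] //=; rewrite last_cat /= lastn.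
by split=> [->|/eqP]; rewrite ?eqxx.
Qed.

Lemma diagonal_language :
  exists beta, ~ Al_NPMV_sel (head_language beta).
Proof.
have [e eP] := NPMV_enumerable.
pose w (b : bool) n := b :: nseq n false.
(* Function number n is defeated at length n + 1, where two words exist: if it may select
   [w true n], only [w false n] of the pair is put into B, and otherwise only [w true n]. *)
exists (fun k => if k is n.+1 then ~~ `[< e n (w false n) (w true n) (w true n) >]
                 else false).
set beta := fun k => _.
move=> [f [/eP[n en] self _]]; have [sub H] := self (w false n) (w true n).
have memB b : head_language beta (w b n) <->
    b = ~~ `[< f (w false n) (w true n) (w true n) >].
  by rewrite /head_language /= size_nseq en.
have [fv|nfv] := pselect (f (w false n) (w true n) (w true n)).
  have B0 : head_language beta (w false n) by apply/memB; rewrite asboolT.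
  have [|_ /(_ _ fv)/memB] := H; last by rewrite asboolT.
  by exists (w false n); split=> //; left.
have B1 : head_language beta (w true n) by apply/memB; rewrite asboolF.
have [|[v fv] /(_ _ fv) Bv] := H; first by exists (w true n); split=> //; right.
case: (sub _ fv) => /= ev; rewrite ev in fv Bv => //.
by move/memB: Bv; rewrite asboolF.
Qed.

(** * The inclusions and their strictness *)

Lemma advice_of_test (P : language) (test : word -> word -> Prop) (L : language) :
  (forall n, exists2 a, size a = n.+1 & forall x, size x = n -> (P x <-> test x a)) ->
  (forall x t c, L (pairing x (t :: c)) <-> test x (t :: c)) ->
  exists h : word -> word, forall x, let a := h (nseq (size x) true) in
    size a = (size x).+1 /\ (P x <-> L (pairing x a)).
Proof.
move=> adv LP.
have /choice[h hP] n : exists a, size a = n.+1 /\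
    forall x, size x = n -> (P x <-> test x a).
  by have [a] := adv n; exists a.
exists (h \o size) => x /=; rewrite size_nseq; have [sa aP] := hP (size x).
(* Advice of length n + 1 is nonempty, the form on which L and the test are known to agree. *)
by split=> //; rewrite aP //; case: (h _) sa => // t c _; rewrite LP.
Qed.

Lemma Al_NP_sel_sub : (Al_NP_sel `<=` advice_n1 (NP `&` coNP))%classic.
Proof.
move=> B [f [[[M pM fM] tf sf] self asf]].
exists (np_language M true); last first.
  exact: advice_of_test (fun n => np_advice n self asf) (np_language_test fM).
split; first exact: one_call_language_NP.
rewrite /coNP /= (_ : (~` _)%classic = np_language M false).
  exact: one_call_language_NP.
by apply/predeqP; exact: np_language_compl.
Qed.

Lemma Al_NPMV_sel_sub : (Al_NPMV_sel `<=` advice_n1 NP `&` advice_n1 coNP)%classic.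
Proof.
move=> B [f [[M pM fM] self asf]]; split.
  exists (np_language M true); first exact: one_call_language_NP.
  exact: advice_of_test (fun n => np_advice n self asf) (np_language_test fM).
exists (~` conp_language M)%classic.
  by rewrite /coNP /= setCK; exact: one_call_language_NP.
have [h hP] := advice_of_test (P := (~` B)%classic)
  (fun n => conp_advice n self asf) (conp_language_test fM).
exists h => x /=; have [sa BP] := hP x; split=> //.
rewrite /setC /= -BP; split=> [Bx nBx|/contrapT //].
exact: nBx.
Qed.

Local Open Scope classical_set_scope.

Theorem theorem5p9 :
  Al_NP_sel `<` advice_n1 (NP `&` coNP) /\
  Al_NPMV_sel `<` (advice_n1 NP `&` advice_n1 coNP).
Proof.
(* One language separates both pairs: an NPSVt selector is an NPMV selector, and a language in both
   NP and coNP serves either advice class. *)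
have [beta nB] := diagonal_language.
have [L [LNP LcoNP] h] := head_language_advice beta.
split; split.
- exact: Al_NP_sel_sub.
- move=> /(_ (head_language beta)) H; apply: nB.
  have [|f [[fN _ _] self asf]] := H; last by exists f.
  by exists L.
- exact: Al_NPMV_sel_sub.
- by move=> /(_ (head_language beta)) H; apply/nB/H; split; exists L.
Qed.
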